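(* Let $\mathbb{F}_q$ be a finite field of odd characteristic and let $f\in \mathbb{F}_q[x]$ be a monic quadratic polynomial with critical point $\gamma$ and orbit type $(2,n)$ for some $n\geq 1$; write $b_i=f^i(\gamma)$. Let $g\in \mathbb{F}_q[x]$ be any monic, irreducible polynomial of even degree whose $f$-type starts with $ns$ (i.e. $g(b_1)$ is not a square in $\mathbb{F}_q$ and $g(b_2)$ is a square in $\mathbb{F}_q$). Then for every monic irreducible factor $H$ of $g(f^2(x))$ in $\mathbb{F}_q[x]$, the type of $H$ at $b_n$ is $s$, i.e. $H(b_n)$ is a square in $\mathbb{F}_q$.
   Context: For $k\ge 1$, $f^k$ denotes the $k$-fold composition of $f$ with itself, and $f^0(x)=x$. The critical point $\gamma$ of a monic quadratic $f$ is the unique $\gamma\in\mathbb{F}_q$ with $f'(\gamma)=0$. The orbit type of $f$ is the pair $(m,n)$ of minimal integers $m\geq 0$, $n\geq 1$ such that $f^m(\gamma)=f^{m+n}(\gamma)$; the post-critical orbit is $\{b_1,\dots,b_{m+n-1}\}$ with $b_i=f^i(\gamma)$. For a monic polynomial $g\in\mathbb{F}_q[x]$ and $\beta\in\mathbb{F}_q$, the type of $g$ at $\beta$ is $s$ if $g(\beta)$ is a square in $\mathbb{F}_q$ and $n$ otherwise. The $f$-type of $g$ is the string of length $m+n-1$ whose $k$-th entry is the type of $g$ at $b_k$. *)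

(* Defs.v *)
From mathcomp Require Import all_boot all_order all_algebra.

Set Implicit Arguments.
Unset Strict Implicit.
Unset Printing Implicit Defensive.

Import GRing.Theory.

Local Open Scope ring_scope.

Definition poly_iter (R : comNzRingType) (f : {poly R}) (k : nat) : {poly R} :=
  iter k (fun p => f \Po p) 'X.

Definition orbit_pt (R : comNzRingType) (f : {poly R}) (x : R) (k : nat) : R :=
  (poly_iter f k).[x].

Definition critical_point (R : nzRingType) (f : {poly R}) (gamma : R) : Prop :=
  f^`().[gamma] = 0.

(* The tail length and the exact period of an orbit are minimal independently
   of each other, so (m, n) is the componentwise least admissible pair. *)
Definition orbit_type (R : comNzRingType) (f : {poly R}) (gamma : R)
    (m n : nat) : Prop :=
  [/\ (0 < n)%N,
      orbit_pt f gamma m = orbit_pt f gamma (m + n)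
    & forall m' n' : nat, (0 < n')%N ->
        orbit_pt f gamma m' = orbit_pt f gamma (m' + n') ->
        (m <= m')%N /\ (n <= n')%N].

Variant sqtype := SqType | NonsqType.

(* Zero counts as a square. *)
Definition type_at (F : finFieldType) (g : {poly F}) (beta : F) : sqtype :=
  if [exists y : F, g.[beta] == y ^+ 2] then SqType else NonsqType.

(* The k-th entry counts from k = 1: entry 0 of the sequence is the type at
   f(gamma), not at gamma. *)
Definition f_type (F : finFieldType) (f : {poly F}) (gamma : F) (m n : nat)
    (g : {poly F}) : seq sqtype :=
  [seq type_at g (orbit_pt f gamma k) | k <- iota 1 (m + n - 1)].

(* Main.v *)
(* Let D be a root of H in a finite extension, B = f(D), A = f(B), d = deg g,
   and let phi be a generator of the Galois group over F (a Frobenius).  The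
   norm of b_1 - A = -(B - gamma)^2 is a nonsquare and d is even, which forces
   phi^d (B - gamma) = -(B - gamma).  Then
   b_2 - A = ((D - gamma) * phi^d (D - gamma))^2 has square norm, which forces
   phi^(2d) D = D, so deg H = 2d.  Put E = phi^d D.  Since b_(n+1) and b_1 are
   symmetric about gamma,
     (D - gamma)^2 + (E - gamma)^2 = 2(gamma - b_1) = (b_n - gamma)^2,
   and hence 2 (b_n - D)(b_n - E) = (b_n + gamma - D - E)^2.  Multiplying the
   d conjugates gives 2^d H(b_n) = w^2 with w fixed by phi, and 2^d is a square in F. *)

Require Import Defs.
From mathcomp Require Import all_boot all_order all_algebra all_fingroup.
From mathcomp Require Import all_field ring.

Set Implicit Arguments.
Unset Strict Implicit.

Import GRing.Theory.

Local Open Scope ring_scope.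

Lemma root_in_finite_extension (F : finFieldType) (p : {poly F}) :
  (1 < size p)%N ->
  exists (L : finFieldType) (iota : {rmorphism F -> L})
         (phi : {rmorphism L -> L}) (a : L),
    [/\ forall y, phi (iota y) = iota y,
        forall x, phi x = x -> exists y, x = iota y
      & root (map_poly iota p) a].
Proof.
move=> p_gt1.
have p_neq0 : p != 0 by rewrite -size_poly_gt0 ltnW.
have [L [rs p_rs _]] := FinSplittingFieldFor p_neq0.
have [alpha gen_alpha alphaE] := finField_galois_generator (sub1v {:L}%AS).
exists (FinFieldExtType L), (GRing.in_alg L).
(* The default 0 is never reached: [p] is not constant, so [rs] is not empty. *)
exists (gal_repr alpha : {rmorphism L -> L}), (head 0 rs).
have fixE x : (alpha x == x) = (x \in 1%VS).
  have /galois_fixedField {1}<- := finField_galois (sub1v {:L}%AS).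
  rewrite (eqP gen_alpha); apply/eqP/fixedFieldP; rewrite ?memvf // => fix_x.
    move=> _ /cycleP[k ->]; elim: k => [|k IHk]; first by rewrite gal_id.
    by rewrite expgSr galM ?memvf // IHk.
  exact/fix_x/cycle_id.
split.
- by move=> y; apply/eqP; rewrite fixE rpredZ ?rpred1.
- by move=> x /eqP; rewrite fixE => /vlineP[y ->]; exists y.
- rewrite (eqp_root p_rs) root_prod_XsubC.
  case: rs p_rs => [|r rs _]; last by rewrite mem_head.
  rewrite big_nil => /eqp_size; rewrite size_map_poly size_poly1 => pE.
  by rewrite pE in p_gt1.
Qed.

(** * Irreducible polynomials as products over [phi]-orbits *)

Section Orbit.

Variables (F : fieldType) (L : finFieldType).
Variables (iota : {rmorphism F -> L}) (phi : {rmorphism L -> L}).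
Hypothesis phi_iota : forall y, phi (iota y) = iota y.
Hypothesis phi_fix : forall x, phi x = x -> exists y, x = iota y.

Lemma order_dvdn_iter (a : L) (m : nat) :
  iter m phi a = a -> (fingraph.order phi a %| m)%N.
Proof.
have phi_inj := fmorph_inj phi.
set e := fingraph.order phi a => am.
have e_gt0 : (0 < e)%N by apply: fingraph.order_gt0.
have am' : iter (m %% e) phi a = a.
  rewrite -[RHS]am [in RHS](divn_eq m e) addnC iterD; congr (iter _ _ _).
  by elim: (m %/ e)%N => // k IHk; rewrite mulSn iterD -IHk iter_order.
(* Below the order, an exponent is the index of its iterate in the orbit, and [a] has index 0. *)
by rewrite /dvdn -(@findex_iter _ phi a (m %% e)) ?ltn_mod // am' findex0.
Qed.

(** The product over the orbit of [a] is stable under [phi], so it descends to F; there it divides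
    [p], and irreducibility makes the two equal. *)
Lemma map_irreducible_orbit (p : {poly F}) (a : L) :
  p \is monic -> irreducible_poly p -> root (map_poly iota p) a ->
  (size p).-1 = fingraph.order phi a /\
  map_poly iota p =
    \prod_(i < (size p).-1) ('X - (iter i phi a)%:P).
Proof.
move=> p_monic [p_gt1 p_irr] pa.
have phi_inj := fmorph_inj phi.
set e := fingraph.order phi a.
pose Q := \prod_(z <- fingraph.orbit phi a) ('X - z%:P).
have QE : Q = \prod_(i < e) ('X - (iter i phi a)%:P).
  rewrite /Q (big_nth a) size_orbit big_mkord.
  by apply: eq_bigr => i _; rewrite nth_traject.
have sizeQ : size Q = e.+1 by rewrite size_prod_XsubC size_orbit.
have phiQ : map_poly phi Q = Q.
  rewrite QE rmorph_prod /=.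
  under eq_bigr => i _ do rewrite rmorphB /= map_polyX map_polyC /= -iterS.
  have: iter e phi a = a := iter_order phi_inj a.
  have: (0 < e)%N by apply: fingraph.order_gt0.
  (* [phi] shifts the factors cyclically: the last one returns to the front. *)
  case: (e) => // k _ /= ea; rewrite big_ord_recr big_ord_recl mulrC /=.
  by rewrite ea.
have [q qE] : exists q, Q = map_poly iota q.
  have qi i : exists y, Q`_i == iota y.
    have [] := phi_fix (x := Q`_i); first by rewrite -coef_map phiQ.
    by move=> y ->; exists y.
  exists (\poly_(i < size Q) xchoose (qi i)); apply/polyP => i.
  rewrite coef_map coef_poly; case: ltnP => [_ | /leq_sizeP/(_ i (leqnn i)) ->].
    exact/eqP/(xchooseP (qi i)).
  exact: esym (rmorph0 iota).
have rootp i : root (map_poly iota p) (iter i phi a).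
  elim: i => //= i; rewrite /root => /eqP H.
  have : phi (map_poly iota p).[iter i phi a] = 0 by rewrite H rmorph0.
  rewrite -horner_map -map_poly_comp /=.
  by rewrite (eq_map_poly phi_iota) => ->.
have Qp : Q %| map_poly iota p.
  apply: uniq_roots_dvdp; last by rewrite uniq_rootsE orbit_uniq.
  by apply/allP => z /trajectP[i _ ->].
have qp : q %= p.
  apply: p_irr.
    by rewrite -(size_map_poly iota) -qE sizeQ eqSS -lt0n fingraph.order_gt0.
  by rewrite -(dvdp_map iota) -qE.
have q_monic : q \is monic.
  by rewrite -(map_monic iota) -qE monic_prod_XsubC.
have -> : p = q by apply/esym/eqP; rewrite -eqp_monic.
by rewrite -qE -(size_map_poly iota) -qE sizeQ QE.
Qed.

End Orbit.

(** * Partial norms and square roots *)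

Section OrbitProduct.

Variables (F : fieldType) (L : fieldType).
Variables (iota : {rmorphism F -> L}) (phi : {rmorphism L -> L}).
Hypothesis phi_iota : forall y, phi (iota y) = iota y.
Hypothesis phi_fix : forall x, phi x = x -> exists y, x = iota y.

(** The norm of [x] when its orbit has length [d]. It is also taken at elements that [iter d phi]
    moves, where it may fail to be rational. *)
Definition orbit_prod (d : nat) (x : L) := \prod_(i < d) iter i phi x.

Lemma iter_rmorphM d : {morph iter d phi : x y / x * y}.
Proof. by elim: d => // d IHd x y; rewrite !iterS IHd rmorphM. Qed.

Lemma iter_rmorphD d : {morph iter d phi : x y / x + y}.
Proof. by elim: d => // d IHd x y; rewrite !iterS IHd rmorphD. Qed.

Lemma iter_rmorphB d : {morph iter d phi : x y / x - y}.
Proof. by elim: d => // d IHd x y; rewrite !iterS IHd rmorphB. Qed.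

Lemma iter_rmorph_eq0 d x : (iter d phi x == 0) = (x == 0).
Proof. by elim: d => // d IHd; rewrite iterS fmorph_eq0. Qed.

Lemma iter_fixed d y : iter d phi (iota y) = iota y.
Proof. by elim: d => // d IHd; rewrite iterS IHd phi_iota. Qed.

Lemma orbit_prodM d : {morph orbit_prod d : x y / x * y}.
Proof.
by move=> x y; rewrite -big_split; apply: eq_bigr => i _; rewrite iter_rmorphM.
Qed.

Lemma orbit_prod_fixed d y : orbit_prod d (iota y) = iota (y ^+ d).
Proof.
rewrite /orbit_prod (eq_bigr (fun=> iota y)) => [|i _]; last exact: iter_fixed.
by rewrite prodr_const card_ord rmorphXn.
Qed.

Lemma orbit_prodD m d x :
  orbit_prod (m + d) x = orbit_prod m x * orbit_prod d (iter m phi x).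
Proof.
rewrite /orbit_prod big_split_ord; congr (_ * _).
by apply: eq_bigr => i _; rewrite -iterD [in RHS]addnC.
Qed.

Lemma orbit_prod_neq0 d x : x != 0 -> orbit_prod d x != 0.
Proof.
by move=> x_neq0; apply/prodf_neq0 => i _; rewrite iter_rmorph_eq0.
Qed.

(** Both sides multiply the first [d.+1] iterates of [x]. *)
Lemma orbit_prod_shift d x :
  phi (orbit_prod d x) * x = orbit_prod d x * iter d phi x.
Proof.
transitivity (\prod_(i < d.+1) iter i phi x); last by rewrite big_ord_recr.
by rewrite big_ord_recl mulrC rmorph_prod.
Qed.

Lemma orbit_prod_rational d x :
  iter d phi x = x -> exists y, orbit_prod d x = iota y.
Proof.
move=> dx; have [-> | x_neq0] := eqVneq x 0.
  (* The witness is a power of 0 because the empty product, at [d = 0], is 1. *)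
  by exists (0 ^+ d); rewrite -(rmorph0 iota) orbit_prod_fixed.
by apply/phi_fix/(mulIf x_neq0); rewrite orbit_prod_shift dx.
Qed.

(* If z = v * phi v * ... * phi^(d-1) v then z^2 is rational, so phi z = +-z,
   and phi z / z = phi^d v / v: this replaces Euler's criterion. *)
Lemma iter_sqrt_nonsquare d v y :
  orbit_prod d (v * v) = iota y -> (forall s, y <> s ^+ 2) ->
  iter d phi v = - v.
Proof.
move=> vy y_nonsq; have [v0 | v_neq0] := eqVneq v 0.
  by rewrite v0 oppr0 -(rmorph0 iota) iter_fixed.
have z_neq0 := orbit_prod_neq0 d v_neq0.
have shift := orbit_prod_shift d v.
rewrite orbit_prodM in vy; set z := orbit_prod d v in vy z_neq0 shift.
have /eqP : phi z ^+ 2 = z ^+ 2 by rewrite -rmorphXn /= !expr2 vy phi_iota.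
rewrite eqf_sqr => /orP[] /eqP phi_z.
  have [s z_s] := phi_fix phi_z; case: (y_nonsq s).
  by apply: (fmorph_inj iota); rewrite -vy z_s rmorphXn.
by apply: (mulfI z_neq0); rewrite -shift phi_z mulNr mulrN.
Qed.

(** Here the product z for [v] is plus or minus [iota s], hence fixed by [phi], and the shift
    identity gives phi^d v = v. *)
Lemma iter_sqrt_square d v s :
  orbit_prod d (v * v) = iota (s ^+ 2) -> iter d phi v = v.
Proof.
move=> vs; have [-> | v_neq0] := eqVneq v 0.
  by rewrite -(rmorph0 iota) iter_fixed.
have z_neq0 := orbit_prod_neq0 d v_neq0.
have shift := orbit_prod_shift d v.
rewrite orbit_prodM rmorphXn -expr2 in vs.
apply: (mulfI z_neq0); rewrite -shift; congr (_ * _).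
move/eqP: vs; rewrite eqf_sqr => /orP[] /eqP ->; rewrite ?rmorphN phi_iota //.
Qed.

End OrbitProduct.

Lemma dvdn_double_eq (d e : nat) : (d %| e)%N -> (e %| d + d)%N ->
  (0 < d)%N -> e <> d -> e = (d + d)%N.
Proof.
move=> /dvdnP[m ->]; rewrite addnn -mul2n => + d_gt0.
rewrite dvdn_pmul2r // => m2; have := @dvdn_leq m 2 isT m2.
by case: m m2 => [|[|[|m]]] //; rewrite mul1n.
Qed.

(** * Monic quadratics and the critical orbit *)

Lemma monic_quadratic_vertex (F : fieldType) (f : {poly F}) (gamma : F) :
  f \is monic -> size f = 3%N -> critical_point f gamma ->
  f = ('X - gamma%:P) ^+ 2 + (f.[gamma])%:P.
Proof.
move=> f_monic f_size.
have f2 : f`_2 = 1 by move/monicP: f_monic; rewrite lead_coefE f_size.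
have fE : f = 'X^2 + f`_1 *: 'X + (f`_0)%:P.
  apply/polyP => i; rewrite !coefE.
  case: i => [|[|[|i]]] /=; rewrite ?f2 ?mulr0 ?mulr1 ?addr0 ?add0r //.
  by rewrite nth_default // f_size.
rewrite /critical_point fE !derivE !hornerE /= => crit.
have -> : f`_1 = - (gamma *+ 2).
  by apply/eqP; rewrite -addr_eq0 addrC; apply/eqP; rewrite -[RHS]crit; ring.
rewrite !(polyCD, polyCM, polyCN, rmorphXn, polyCMn) /= -mul_polyC polyCN polyCMn.
ring.
Qed.

Lemma orbit_ptS (R : comNzRingType) (f : {poly R}) x k :
  orbit_pt f x k.+1 = f.[orbit_pt f x k].
Proof. by rewrite /orbit_pt /poly_iter iterS horner_comp. Qed.

Lemma type_atP (F : finFieldType) (g : {poly F}) b :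
  if type_at g b is SqType then exists s, g.[b] = s ^+ 2
  else forall s, g.[b] <> s ^+ 2.
Proof.
rewrite /type_at; case: ifP => [/existsP[s /eqP] | /negbT/existsPn nsq s /eqP].
  by exists s.
by rewrite (negPf (nsq s)).
Qed.

Lemma type_at_square (F : finFieldType) (g : {poly F}) b s :
  g.[b] = s ^+ 2 -> type_at g b = SqType.
Proof. by rewrite /type_at => /eqP E; case: existsP => // -[]; exists s. Qed.

(** Periodicity gives b_(n+1) and b_1 the same image under [f], while tail length 2 keeps them
    distinct; so they are reflections of each other in [gamma]. *)
Lemma orbit_type2_preperiod (F : fieldType) (f : {poly F}) gamma n :
  f \is monic -> size f = 3%N -> critical_point f gamma ->
  orbit_type f gamma 2 n ->
  (orbit_pt f gamma n - gamma) ^+ 2 = (gamma - orbit_pt f gamma 1) *+ 2.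
Proof.
move=> f_monic f_size crit [n_gt0 per min].
have fE := monic_quadratic_vertex f_monic f_size crit.
have fxE x : f.[x] = (x - gamma) ^+ 2 + orbit_pt f gamma 1.
  by rewrite {1}fE !hornerE orbit_ptS /orbit_pt /= hornerX.
have neq : orbit_pt f gamma n.+1 != orbit_pt f gamma 1.
  by apply/eqP => E; have [] := min 1%N n n_gt0 (esym E).
have : (orbit_pt f gamma n.+1 - gamma) ^+ 2 = (orbit_pt f gamma 1 - gamma) ^+ 2.
  by apply: (addIr (orbit_pt f gamma 1)); rewrite -!fxE -!orbit_ptS.
move/eqP; rewrite eqf_sqr => /orP[/eqP/addIr E | /eqP].
  by rewrite E eqxx in neq.
rewrite orbit_ptS fxE => E; apply/eqP; rewrite -subr_eq0; apply/eqP.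
by rewrite -[RHS](subrr (- (orbit_pt f gamma 1 - gamma))) -{1}E; ring.
Qed.

Unset Implicit Arguments.
Set Strict Implicit.

Theorem theorem1p3 (F : finFieldType) (Fodd : 2%N \notin [pchar F])
    (f : {poly F}) (f_monic : f \is monic) (f_quadratic : size f = 3%N)
    (gamma : F) (gamma_crit : critical_point f gamma)
    (n : nat) (f_orbit : orbit_type f gamma 2 n)
    (g : {poly F}) (g_monic : g \is monic) (g_irr : irreducible_poly g)
    (g_even : ~~ odd (size g).-1)
    (g_type : take 2 (f_type f gamma 2 n g) = [:: NonsqType; SqType])
    (H : {poly F}) (H_monic : H \is monic) (H_irr : irreducible_poly H)
    (H_factor : H %| g \Po poly_iter f 2) :
  type_at H (orbit_pt f gamma n) = SqType.
Proof.
have bn := orbit_type2_preperiod f_monic f_quadratic gamma_crit f_orbit.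
have [n_gt0 _ _] := f_orbit.
have fE := monic_quadratic_vertex f_monic f_quadratic gamma_crit.
have b1E : orbit_pt f gamma 1 = f.[gamma].
  by rewrite orbit_ptS /orbit_pt /= hornerX.
have b2E : orbit_pt f gamma 2 = (f.[gamma] - gamma) ^+ 2 + f.[gamma].
  by rewrite orbit_ptS b1E {1}fE !hornerE.
have [g1 g2] : (forall s, g.[f.[gamma]] <> s ^+ 2) /\
    exists s, g.[(f.[gamma] - gamma) ^+ 2 + f.[gamma]] = s ^+ 2.
  have := type_atP g (orbit_pt f gamma 1); have := type_atP g (orbit_pt f gamma 2).
  (* The f-type has length n + 1, at least 2, so [take 2] reads the types at b_1 and b_2. *)
  move: g_type; rewrite /f_type; case: (n) n_gt0 => // m _.
  by rewrite /= => -[-> ->]; rewrite b1E b2E.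
have [L [iota [phi [D [phi_iota phi_fix HD]]]]] := root_in_finite_extension H_irr.1.
set d := (size g).-1 in g_even.
set c := f.[gamma] in fE b1E b2E g1 g2.
set b := orbit_pt f gamma n in bn *.
rewrite b1E in bn.
have [orderD HE] := map_irreducible_orbit phi_iota phi_fix H_monic H_irr HD.
pose fL := map_poly iota f.
have fLE x : fL.[x] = (x - iota gamma) ^+ 2 + iota c.
  rewrite /fL fE rmorphD rmorphXn rmorphB /= !map_polyC map_polyX /=.
  by rewrite !hornerE.
pose A := fL.[fL.[D]].
have gA : root (map_poly iota g) A.
  have : root (map_poly iota (g \Po poly_iter f 2)) D.
    by move: HD; rewrite -!dvdp_XsubCl => /dvdp_trans; apply; rewrite dvdp_map.
  by rewrite /poly_iter /= comp_polyXr !map_comp_poly !rootE !horner_comp.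
have [orderA gE] := map_irreducible_orbit phi_iota phi_fix g_monic g_irr gA.
have horner_g y : iota g.[y] = orbit_prod phi d (iota y - A).
  rewrite -horner_map gE horner_prod; apply: eq_bigr => i _.
  by rewrite hornerXsubC iter_rmorphB iter_fixed.
have horner_H y : iota H.[y] = orbit_prod phi (size H).-1 (iota y - D).
  rewrite -horner_map HE horner_prod; apply: eq_bigr => i _.
  by rewrite hornerXsubC iter_rmorphB iter_fixed.
pose x := D - iota gamma; pose y := fL.[D] - iota gamma.
have yE : y = x * x + iota (c - gamma) by rewrite /y fLE rmorphB /x; ring.
have AE : A = y * y + iota c by rewrite /A fLE.
have two_neq0 : (2%:R : F) != 0 by rewrite inE /= in Fodd.
have two_L : (2%:R : L) != 0 by rewrite -(rmorph_nat iota) fmorph_eq0.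
have phi_y : iter d phi y = - y.
  apply: (iter_sqrt_nonsquare phi_iota phi_fix _ g1); rewrite horner_g.
  have -> : y * y = iota (-1) * (iota c - A) by rewrite AE rmorphN1; ring.
  rewrite orbit_prodM orbit_prod_fixed // -signr_odd (negPf g_even).
  by rewrite rmorph1 mul1r.
(* Otherwise A = b_1, and g(b_1) = 0 would be a square. *)
have y_neq0 : y != 0.
  apply/eqP => y0; apply: (g1 0); apply: (fmorph_inj iota).
  move/rootP: gA; rewrite AE y0 mulr0 add0r horner_map => ->.
  by rewrite expr0n rmorph0.
have phi_y_neq : iter d phi y != y.
  by rewrite phi_y eq_sym -addr_eq0 -mulr2n -mulr_natr mulf_neq0.
(* [E] is centred at [gamma], like [x]: it is phi^d D - [gamma]. *)
pose E := iter d phi x.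
have EE : E * E = - y - iota (c - gamma).
  rewrite -phi_y -(iter_fixed phi_iota d) -iter_rmorphB -iter_rmorphM yE.
  by congr (iter d phi _); ring.
(* If [E] vanished so would [x], and [y] would lie in F, fixed by phi^d. *)
have E_neq0 : E != 0.
  apply/eqP => E0; have x0 : x = 0.
    by apply/eqP; move/eqP: E0; rewrite iter_rmorph_eq0.
  by move: phi_y_neq; rewrite yE x0 mulr0 add0r iter_fixed // eqxx.
have phi_E : iter d phi E = x.
  have [s gs] := g2.
  have sq : iter d phi (x * E) = x * E.
    apply: (iter_sqrt_square phi_iota (s := s)).
    rewrite -gs horner_g; congr (orbit_prod _ _ _).
    (* With k = c - [gamma], (xE)^2 = (y - k)(-y - k) = k^2 - y^2 = b_2 - A. *)
    have xx : x * x = y - iota (c - gamma) by rewrite yE addrK.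
    rewrite mulrACA xx EE AE.
    by rewrite !(rmorphD, rmorphXn, rmorphB) /=; ring.
  by apply: (mulIf E_neq0); rewrite -[RHS]sq iter_rmorphM mulrC.
have xD : D = x + iota gamma by rewrite /x subrK.
have iter_D m : iter m phi D = iter m phi x + iota gamma.
  by rewrite /x iter_rmorphB iter_fixed // subrK.
(* d divides deg H because A is a polynomial in D over F; deg H divides 2d because phi^(2d) D = D;
   deg H = d would make phi^d fix [y]. *)
have degH : (size H).-1 = (d + d)%N.
  apply: dvdn_double_eq.
  - rewrite {1}/d orderA order_dvdn_iter //.
    have fL_phi z : phi fL.[z] = fL.[phi z].
      by rewrite !fLE rmorphD rmorphXn rmorphB !phi_iota.
    have iter_f m z : iter m phi fL.[z] = fL.[iter m phi z].
      by elim: m => // m IHm; rewrite !iterS IHm fL_phi.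
    by rewrite /A !iter_f orderD (iter_order (fmorph_inj phi)).
  - by rewrite orderD order_dvdn_iter // iter_D iterD -/E phi_E -xD.
  - by rewrite /d -subn1 subn_gt0; case: g_irr.
  - move=> e_d; move/eqP: phi_y_neq; apply.
    have dD : iter d phi x = x.
      rewrite /x iter_rmorphB iter_fixed // -e_d orderD iter_order //.
      exact: fmorph_inj.
    by rewrite yE iter_rmorphD iter_rmorphM dD iter_fixed.
clearbody x.
pose t := iota (b - gamma) - x - E.
(* phi^d exchanges [x] and [E], so it fixes [t]. *)
have [s ts] : exists s, orbit_prod phi d t = iota s.
  apply: (orbit_prod_rational phi_iota phi_fix).
  by rewrite /t !iter_rmorphB iter_fixed // phi_E -/E addrAC.
have tt : t * t = iota 2%:R * ((iota b - D) * iter d phi (iota b - D)).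
  rewrite iter_rmorphB iter_fixed // iter_D -/E xD.
  have : iota (b - gamma) ^+ 2 = x * x + E * E.
    rewrite -rmorphXn bn EE yE !(rmorphB, rmorphMn) /=; ring.
  (* With u = b - [gamma], the added zero turns (u - x - E)^2 into 2(u - x)(u - E). *)
  move=> bb; transitivity (t * t + (iota (b - gamma) ^+ 2 - (x * x + E * E))).
    by rewrite bb subrr addr0.
  by rewrite /t !rmorphB /=; ring.
(* The 2d conjugates of b - D split into two runs of d, and the i-th terms of the runs are
   paired. *)
have Hs : 2%:R ^+ d * H.[b] = s ^+ 2.
  apply: (fmorph_inj iota); rewrite rmorphM horner_H degH orbit_prodD.
  rewrite -orbit_prodM -(orbit_prod_fixed phi_iota) -orbit_prodM -tt.
  by rewrite orbit_prodM ts rmorphXn.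
apply: (type_at_square (s := s / 2%:R ^+ d./2)).
have dE : (d./2 * 2)%N = d.
  by rewrite muln2 -[RHS]odd_double_half (negPf g_even).
by rewrite expr_div_n -exprM dE -Hs mulrC mulKf // expf_neq0.
Qed.
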